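(* Let $T$ be a tree containing a vertex $x$ such that the distance between $x$ and every leaf of $T$ is at least $2$. Then $C_2(T)\ge 3$.
   Context: All graphs are finite, simple and undirected. A set $S\subseteq V(G)$ is a $2$-dominating set of $G$ if every vertex of $V(G)\setminus S$ has at least $2$ neighbours in $S$. Two sets $U_1,U_2\subseteq V(G)$ form a $2$-coalition if neither $U_1$ nor $U_2$ is a $2$-dominating set of $G$, but $U_1\cup U_2$ is. A $2$-coalition partition of $G$ is a partition $\Theta$ of $V(G)$ into nonempty sets such that every set of $\Theta$ either is a $2$-dominating set of $G$ with exactly $2$ elements, or forms a $2$-coalition with some other set of $\Theta$. The $2$-coalition number $C_2(G)$ is the maximum number of sets in a $2$-coalition partition of $G$.
   Formalization: The tree T is assumed to have at least two vertices, because the one-vertex tree has no leaf and so satisfies the condition vacuously, but has no 2-coalition partition with three sets. *)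

(* Defs.v *)
From mathcomp Require Import all_boot.

Set Implicit Arguments.
Unset Strict Implicit.
Unset Printing Implicit Defensive.

Record sgraph := SGraph {
  vertex :> finType;
  edge : rel vertex;
  edge_sym : symmetric edge;
  edge_irrefl : irreflexive edge
}.

Definition neighbours (G : sgraph) (v : G) : {set G} := [set u | edge v u].

Definition leaf (G : sgraph) (v : G) : bool := #|neighbours v| == 1.

(* [:: u; v] is a ucycle for every edge uv, so only ucycles with at least
   three vertices are cycles of the graph. *)
Definition acyclic (G : sgraph) : Prop :=
  forall c : seq G, ucycle (@edge G) c -> size c <= 2.

Definition connected (G : sgraph) : Prop :=
  0 < #|G| /\ forall x y : G, connect (@edge G) x y.

Definition tree (G : sgraph) : Prop := connected G /\ acyclic G.

(* The least length of a walk from x to y. A shortest walk has fewer than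
   #|G| edges; if there is no walk the value is #|G|, which is never used in
   a connected graph. *)
Definition dist (G : sgraph) (x y : G) : nat :=
  find (fun n => [exists p : n.-tuple G, path (@edge G) x p && (last x p == y)])
       (iota 0 #|G|).

Definition two_dominating (G : sgraph) (S : {set G}) : bool :=
  [forall v in ~: S, 2 <= #|neighbours v :&: S|].

Definition two_coalition (G : sgraph) (U1 U2 : {set G}) : bool :=
  [&& ~~ two_dominating U1, ~~ two_dominating U2
    & two_dominating (U1 :|: U2)].

Definition two_coalition_partition (G : sgraph) (P : {set {set G}}) : bool :=
  partition P [set: G] &&
  [forall A in P,
     (two_dominating A && (#|A| == 2)) ||
     [exists B in P, (B != A) && two_coalition A B]].

(* The value is 0 when the graph has no 2-coalition partition. *)
Definition C2 (G : sgraph) : nat :=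
  \max_(P : {set {set G}} | two_coalition_partition P) #|P|.

(* Main.v *)
Require Import Defs.
From mathcomp Require Import all_boot.

(** Take the three sets {x}, N(x) and the set R of all other vertices. Since x
    and its neighbours are not leaves and T has no triangle, {x} ∪ R and
    N(x) ∪ R are 2-dominating. R alone does not dominate x, {x} alone gives a
    neighbour of x only one neighbour, and, as T has no 4-cycle, N(x) alone
    gives a vertex at distance 2 from x only one neighbour. *)

Section Graph.
Set Implicit Arguments.
Unset Strict Implicit.
Variable G : sgraph.
Implicit Types (u v w : G) (S : {set G}).

Lemma edge_neq u v : edge u v -> u != v.
Proof. by apply: contraTneq => ->; rewrite edge_irrefl. Qed.

Lemma acyclic_triangle_free u v w :
  acyclic G -> edge u v -> edge v w -> edge w u = false.
Proof.
move=> acG uv vw; apply/negP => wu.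
suff: size [:: u; v; w] <= 2 by [].
apply: acG; rewrite /ucycle /= uv vw wu /= !inE negb_or.
by rewrite (edge_neq uv) (edge_neq vw) (eq_sym u) (edge_neq wu).
Qed.

(** If [v] and [z] differed, [u, v, w, z] would be four distinct vertices forming a cycle. *)
Lemma acyclic_unique_common_neighbour u v w z :
  acyclic G -> u != w -> edge u v -> edge v w -> edge w z -> edge z u ->
  v = z.
Proof.
move=> acG uw uv vw wz zu; apply/eqP; apply: contraT => vz.
suff: size [:: u; v; w; z] <= 2 by [].
apply: acG; rewrite /ucycle /= uv vw wz zu /= !inE !negb_or.
by rewrite uw vz (edge_neq uv) (edge_neq vw) (edge_neq wz) (eq_sym u)
           (edge_neq zu).
Qed.

(** A path from [v] to any other vertex leaves [v] through a neighbour. *)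
Lemma connected_neighbours_gt0 v : connected G -> 1 < #|G| -> 0 < #|neighbours v|.
Proof.
case=> _ conG; rewrite [#|G|](cardD1 v) inE ltnS => /card_gt0P[u].
rewrite !inE andbT => uv.
have /connectP[[|w p] /= vp uE] := conG v u; first by rewrite uE eqxx in uv.
by apply/card_gt0P; exists w; rewrite inE; case/andP: vp.
Qed.

(** [before_find] at indices 0 and 1 excludes walks of these lengths; [1 < #|G|] puts both indices
    inside [iota 0 #|G|]. *)
Lemma dist_ge2 u v : 1 < #|G| -> 2 <= dist u v -> (u != v) && ~~ edge u v.
Proof.
move=> G2 uv; apply/andP; split.
- apply/negP => /eqP uvE.
  have /negP[] := negbT (before_find 0 (ltnW uv)).
  rewrite nth_iota ?(ltnW G2) //.
  by apply/existsP; exists [tuple]; rewrite /= uvE.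
- apply/negP => uvE.
  have /negP[] := negbT (before_find 0 uv).
  rewrite nth_iota //.
  by apply/existsP; exists [tuple v]; rewrite /= uvE eqxx.
Qed.

Lemma two_dominatingPn S v :
  v \notin S -> #|neighbours v :&: S| <= 1 -> ~~ two_dominating S.
Proof.
move=> vS Nv; apply/negP => /forall_inP/(_ v).
by rewrite inE ltnNge Nv => /(_ vS).
Qed.

End Graph.

Theorem theorem13 (T : sgraph) (hT : tree T) (hn : 1 < #|T|) (x : T)
    (hx : forall v : T, leaf v -> 2 <= dist x v) :
  3 <= C2 T.
Proof.
have [conT acT] := hT.
(* Such a [v] is too close to [x] to be a leaf, and by connectedness its degree is positive. *)
have deg2 v : (v == x) || edge x v -> 1 < #|neighbours v|.
  move=> xv; rewrite ltn_neqAle eq_sym connected_neighbours_gt0 // andbT.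
  apply/negP => /hx/(dist_ge2 hn).
  by rewrite (eq_sym x); case/orP: xv => ->; rewrite ?andbF.
pose C := neighbours x; pose R := ~: (x |: C).
have xC : x \notin C by rewrite inE edge_irrefl.
have xR : x \notin R by rewrite !inE eqxx.
have [y yC] : exists y, y \in C.
  by apply/card_gt0P; rewrite ltnW // deg2 ?eqxx.
have xy : edge x y by rewrite inE in yC.
(* [z] is a second neighbour of [y], besides [x]; it lies outside [C] because [x, y, z] is not a
   triangle. *)
have [z zR yz] : exists2 z, z \in R & edge y z.
  have : 1 < #|neighbours y| by rewrite deg2 ?xy ?orbT.
  rewrite (cardD1 x) inE edge_sym xy ltnS => /card_gt0P[z].
  rewrite !inE => /andP[zx yz]; exists z => //.
  by rewrite !inE negb_or zx /= edge_sym (acyclic_triangle_free _ xy yz).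
have [zx zC] : z != x /\ z \notin C by move: zR; rewrite !inE negb_or => /andP[].
have yR : y \notin R by rewrite !inE xy orbT.
have xNdom : ~~ two_dominating [set x].
  apply: (@two_dominatingPn _ _ y); first by rewrite inE eq_sym edge_neq.
  by rewrite (leq_trans (subset_leq_card (subsetIr _ _))) ?cards1.
have CNdom : ~~ two_dominating C.
  apply: (@two_dominatingPn _ _ z) => //.
  (* Every common neighbour of [x] and [z] equals [y]. *)
  rewrite -(cards1 y) subset_leq_card //; apply/subsetP => w.
  rewrite !inE => /andP[zw xw]; apply/eqP.
  by apply: (@acyclic_unique_common_neighbour _ x _ z) => //;
     rewrite 1?eq_sym 1?edge_sym.
have RNdom : ~~ two_dominating R.
  apply: (@two_dominatingPn _ _ x) => //.
  rewrite [_ :&: _](_ : _ = set0) ?cards0 //.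
  by apply/setP => w; rewrite !inE; case: edge; rewrite ?orbT.
have xRdom : two_dominating (R :|: [set x]).
  apply/forall_inP => v; rewrite !inE !negb_or negb_and !negbK.
  case/andP => /orP[->//|xv] _.
  (* [C] has no inner edges, so all neighbours of [v] lie in [R :|: [set x]] and [deg2] applies. *)
  rewrite (setIidPl _) ?deg2 ?xv ?orbT //; apply/subsetP => w; rewrite !inE => vw.
  by rewrite [edge x w]edge_sym (acyclic_triangle_free _ xv vw) // orbF orNb.
have CRdom : two_dominating (R :|: C).
  apply/forall_inP => v; rewrite !inE => vRC.
  (* Only [x] is missing from [R :|: C], and its whole neighbourhood is [C]. *)
  have /eqP-> : v == x by move: vRC; case: (v == x) => //=; case: edge.
  rewrite (setIidPl _) ?deg2 ?eqxx //; apply/subsetP => w.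
  by rewrite !inE => ->; rewrite orbT.
have xneC : [set x] != C by apply: contraNneq xC => <-; rewrite set11.
have xneR : [set x] != R by apply: contraNneq xR => <-; rewrite set11.
have CneR : C != R by apply: contraNneq yR => <-.
pose P := [set [set x]; C; R].
have P3 : #|P| = 3.
  by rewrite /P -setUA !cardsU1 cards1 !inE negb_or xneC xneR CneR.
rewrite -{1}P3; apply: leq_bigmax_cond; apply/andP; split.
- apply/and3P; split.
  + rewrite /cover eqEsubset subsetT; apply/subsetP => v _; apply/bigcupP.
    have [vx|vx] := boolP (v == x).
      by exists [set x]; rewrite ?inE ?eqxx.
    have [xv|xv] := boolP (edge x v).
      by exists C; rewrite !inE ?eqxx ?orbT.
    by exists R; rewrite !inE ?eqxx ?orbT // negb_or vx.
  + have dxC : [disjoint [set x] & C] by rewrite disjoints1.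
    have dxR : [disjoint [set x] & R] by rewrite disjoints1.
    have dCR : [disjoint C & R].
      by rewrite disjoint_sym disjoints_subset setCS subsetUr.
    apply/trivIsetP => A B; rewrite !inE => /orP[/orP[]|] /eqP->;
      case/orP => [/orP[]|] /eqP->; rewrite ?eqxx //;
      by rewrite disjoint_sym.
  + rewrite !inE !negb_or !(eq_sym set0); apply/andP; split; last first.
      by apply/set0Pn; exists z.
    by apply/andP; split; apply/set0Pn; [exists x; rewrite set11|exists y].
(* [R] is the partner of both [[set x]] and [C]; for [R] itself, [C] is chosen. *)
- apply/forall_inP => A; rewrite !inE => AP; apply/orP; right; apply/exists_inP.
  case/orP: AP => [/orP[]|] /eqP->.
  + exists R; first by rewrite !inE eqxx !orbT.
    by rewrite eq_sym xneR /two_coalition xNdom RNdom setUC.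
  + exists R; first by rewrite !inE eqxx !orbT.
    by rewrite eq_sym CneR /two_coalition CNdom RNdom setUC.
  + exists C; first by rewrite !inE eqxx !orbT.
    by rewrite CneR /two_coalition CNdom RNdom.
Qed.
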